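(* Let $(M,\varphi,\xi,\eta,g)$ be a contact pseudo-metric manifold and $h=\frac12\pounds_\xi\varphi$. Then the $\xi$-sectional curvatures satisfy $$K(\xi,X)=\varepsilon\{1-\varepsilon_X\,g(h^2X,X)-\varepsilon_X\,g((\nabla_\xi h)X,\varphi X)\}$$ and $$K(\xi,X)=K(\xi,\varphi X)-2\varepsilon\,\varepsilon_X\,g((\nabla_\xi h)X,\varphi X)$$ for any unit vector $X\in\mathrm{Ker}\,\eta$, where $\varepsilon_X=g(X,X)=\pm1$.
   Context: An almost contact pseudo-metric manifold $(M,\varphi,\xi,\eta,g)$ is a smooth connected manifold $M$ of dimension $2n+1$ with a $(1,1)$ tensor field $\varphi$, a vector field $\xi$, a $1$-form $\eta$ and a pseudo-Riemannian metric $g$ such that $\varphi^2=-I+\eta\otimes\xi$, $\eta(\xi)=1$, $\varphi\xi=0$, $\eta\circ\varphi=0$, and $g(\varphi X,\varphi Y)=g(X,Y)-\varepsilon\eta(X)\eta(Y)$ for all $X,Y$, where $\varepsilon=\pm1$ is a fixed sign; this condition is equivalent to $\eta(X)=\varepsilon g(X,\xi)$ together with $g(\varphi X,Y)=-g(X,\varphi Y)$, and so $g(\xi,\xi)=\varepsilon$. It is a contact pseudo-metric manifold if $d\eta=\Phi$, where $\Phi(X,Y)=g(X,\varphi Y)$ and $d\eta(X,Y)=\frac12\big(X\eta(Y)-Y\eta(X)-\eta([X,Y])\big)$. $\nabla$ is the Levi-Civita connection of $g$, $R(X,Y)=[\nabla_X,\nabla_Y]-\nabla_{[X,Y]}$,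 $\pounds$ is the Lie derivative, and $(\nabla_XA)Y=\nabla_X(AY)-A(\nabla_XY)$ for a $(1,1)$ tensor $A$. For $X\in\mathrm{Ker}\,\eta$ with $g(X,X)=\varepsilon_X=\pm1$ (a unit vector), the $\xi$-sectional curvature is $K(\xi,X)=\varepsilon\,\varepsilon_X\,g(R(\xi,X)X,\xi)$. *)

(* Defs.v *)
From HB Require Import structures.
From mathcomp Require Import all_boot all_order all_algebra.
From mathcomp Require Import boolp classical_sets functions cardinality.
From mathcomp Require Import reals topology normedtype derive.
From mathcomp Require Import ring.

Set Implicit Arguments.
Unset Strict Implicit.
Unset Printing Implicit Defensive.

Import Order.TTheory GRing.Theory Num.Theory.
Import numFieldNormedType.Exports.

Local Open Scope classical_set_scope.
Local Open Scope ring_scope.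

Section Smoothness.
Variables (R : realType) (d : nat).
Implicit Types (U : set 'rV[R]_d) (f g : 'rV[R]_d -> R).

(* Only used for open U: all partial derivatives of order at most k exist and
   are continuous at every point of U. *)
Fixpoint Ck (k : nat) U f : Prop :=
  (forall x, U x -> {for x, continuous f}) /\
  if k is k'.+1 then
    forall i : 'I_d, (forall x, U x -> derivable f x (delta_mx 0 i)) /\
                     Ck k' U (fun x => 'D_(delta_mx 0 i) f x)
  else True.

Definition smooth_on U f := forall k, Ck k U f.

Lemma Ck_continuous k U f x : Ck k U f -> U x -> {for x, continuous f}.
Proof. by case: k => [|k] [cf _]; exact: cf. Qed.

Lemma CkW k U f : Ck k.+1 U f -> Ck k U f.
Proof.
elim: k f => [|k IH] f [cf df]; first by split.
by split=> // i; have [dfi Cfi] := df i; split=> //; exact: IH.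
Qed.

Lemma Ck_ext k U f g : open U -> (forall x, U x -> f x = g x) ->
  Ck k U f -> Ck k U g.
Proof.
move=> oU.
have nfg (u v : 'rV[R]_d -> R) x : (forall x, U x -> u x = v x) -> U x ->
    {near x, u =1 v}.
  by move=> fg Ux; near=> y; apply: fg; near: y; exact: open_nbhs_nbhs.
have cfg (u v : 'rV[R]_d -> R) x : (forall x, U x -> u x = v x) -> U x ->
    {for x, continuous u} -> {for x, continuous v}.
  move=> fg Ux; rewrite /prop_for /continuous_at -(fg _ Ux); apply: cvg_trans.
  exact: (@near_eq_cvg _ _ (nbhs x) _ u v (nfg u v x fg Ux)).
elim: k f g => [|k IH] f g fg [cf df].
  by split=> // x Ux; exact: cfg (cf _ Ux).
split=> [x Ux|i]; first exact: cfg (cf _ Ux).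
have [dfi Cfi] := df i; split=> [x Ux|].
  exact: near_eq_derivable (nfg _ _ _ fg Ux) (dfi _ Ux).
by apply: IH Cfi => x Ux; apply: near_eq_derive; exact: nfg.
Unshelve. all: by end_near. Qed.

Lemma Ck_cst k U (c : R) : Ck k U (cst c).
Proof.
have cc x : {for x, continuous (cst c : 'rV[R]_d -> R)}.
  exact: cst_continuous.
elim: k c cc => [|k IH] c cc; split=> // i.
split=> [x _|]; first exact: derivable_cst.
rewrite (_ : (fun x => _) = cst 0); last by apply/funext => x; exact: derive_cst.
by apply: IH => x; exact: cst_continuous.
Qed.

Lemma Ck_add k U f g : open U -> Ck k U f -> Ck k U g -> Ck k U (f + g).
Proof.
move=> oU; elim: k f g => [|k IH] f g [cf df] [cg dg].
  by split=> // x Ux; apply: continuousD; [exact: cf|exact: cg].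
split=> [x Ux|i]; first by apply: continuousD; [exact: cf|exact: cg].
have [dfi Cfi] := df i; have [dgi Cgi] := dg i; split=> [x Ux|].
  by apply: derivableD; [exact: dfi|exact: dgi].
apply: Ck_ext (IH _ _ Cfi Cgi) => // x Ux /=.
by rewrite deriveD //; [exact: dfi|exact: dgi].
Qed.

Lemma Ck_mul k U f g : open U -> Ck k U f -> Ck k U g -> Ck k U (f * g).
Proof.
move=> oU; elim: k f g => [|k IH] f g Cf Cg; have [cf df] := Cf;
  have [cg dg] := Cg.
  by split=> // x Ux; apply: continuousM; [exact: cf|exact: cg].
split=> [x Ux|i]; first by apply: continuousM; [exact: cf|exact: cg].
have [dfi Cfi] := df i; have [dgi Cgi] := dg i; split=> [x Ux|].
  by apply: derivableM; [exact: dfi|exact: dgi].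
apply: Ck_ext (Ck_add oU (IH _ _ (CkW Cf) Cgi) (IH _ _ (CkW Cg) Cfi)) => //.
by move=> x Ux /=; rewrite deriveM //; [exact: dfi|exact: dgi].
Qed.

End Smoothness.

(* A homeomorphism from the open set chart_dom onto an open subset of R^d;
   chart_map and chart_inv take irrelevant values elsewhere. *)
Record chart (R : realType) (T : topologicalType) (d : nat) := Chart {
  chart_dom : set T;
  chart_map : T -> 'rV[R]_d;
  chart_inv : 'rV[R]_d -> T;
  chart_dom_open : open chart_dom;
  chart_img_open : open (chart_map @` chart_dom);
  chart_mapK : forall p, chart_dom p -> chart_inv (chart_map p) = p;
  chart_map_continuous :
    forall p, chart_dom p -> {for p, continuous chart_map};
  chart_inv_continuous :
    forall x, (chart_map @` chart_dom) x -> {for x, continuous chart_inv} }.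

Record manifold (R : realType) (d : nat) := Manifold {
  carrier :> topologicalType;
  manifold_hausdorff : hausdorff_space carrier;
  manifold_second_countable : @second_countable carrier;
  manifold_connected : connected [set: carrier];
  atlas : set (chart R carrier d);
  atlas_cover : forall p, exists2 c, atlas c & chart_dom c p;
  atlas_compatible : forall c c', atlas c -> atlas c' -> forall i : 'I_d,
    smooth_on (chart_map c @` (chart_dom c `&` chart_dom c'))
              (fun x => chart_map c' (chart_inv c x) 0 i) }.

Section SmoothFunctions.
Variables (R : realType) (d : nat) (M : manifold R d).

Definition is_smooth (f : M -> R) : Prop := forall c, atlas c ->
  smooth_on (chart_map c @` chart_dom c) (f \o chart_inv c).

Definition smooth_pred : {pred M -> R} := mem [set f | is_smooth f].

Record smooth_fun := SmoothFun {
  smooth_val :> M -> R;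
  smooth_valP : smooth_val \in smooth_pred }.

HB.instance Definition _ := [isSub for smooth_val].
HB.instance Definition _ := [Choice of smooth_fun by <:].

Lemma smooth_cst_subproof (c : R) : (cst c : M -> R) \in smooth_pred.
Proof. by apply/mem_set => a aA k; exact: Ck_cst. Qed.

Definition scst (c : R) : smooth_fun := SmoothFun (smooth_cst_subproof c).

Lemma smooth_subring_closed : subring_closed smooth_pred.
Proof.
have smM f g : f \in smooth_pred -> g \in smooth_pred -> f * g \in smooth_pred.
  move=> /set_mem sf /set_mem sg; apply/mem_set => c cA k.
  exact (Ck_mul (@chart_img_open _ _ _ c) (sf c cA k) (sg c cA k)).
split=> [|f g sf sg|//]; first exact: smooth_cst_subproof.
have -> : f - g = f + cst (-1) * g.
  by apply/funext => x; rewrite /= !fctE mulN1r.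
have /set_mem sg' := smM _ _ (smooth_cst_subproof (-1)) sg.
move/set_mem: sf => sf; apply/mem_set => c cA k.
exact (Ck_add (@chart_img_open _ _ _ c) (sf c cA k) (sg' c cA k)).
Qed.

HB.instance Definition _ :=
  GRing.isSubringClosed.Build _ smooth_pred smooth_subring_closed.
HB.instance Definition _ := GRing.SubChoice_isSubComPzRing.Build
  _ _ smooth_fun (subringClosedP _).

End SmoothFunctions.

Section VectorFields.
Variables (R : realType) (d : nat) (M : manifold R d).
Local Notation C := (smooth_fun M).

(* Vector fields are the derivations of the R-algebra of smooth functions; the
   tangent vector of X at p is f |-> X f p. *)
Definition derivation (X : C -> C) : Prop :=
  (forall (a : R) f g, X (scst M a * f + g) = scst M a * X f + X g) /\
  (forall f g, X (f * g) = X f * g + f * X g).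

Definition derivation_pred : {pred C -> C^o} := mem [set X | derivation X].

Record vfield := VField {
  vfield_fun :> C -> C;
  vfield_funP : (vfield_fun : C -> C^o) \in derivation_pred }.

HB.instance Definition _ := [isSub for vfield_fun : vfield -> (C -> C^o)].
HB.instance Definition _ := [Choice of vfield by <:].

Lemma derivation_submod_closed : submod_closed derivation_pred.
Proof.
split=> [|a X Y /set_mem[Xl Xm] /set_mem[Yl Ym]]; apply/mem_set; split.
- by move=> b f g; rewrite /= mulr0 addr0.
- by move=> f g; rewrite /= mulr0 mul0r addr0.
- move=> b f g; rewrite !fctE Xl Yl /GRing.scale /= !mulrDr -!addrA.
  by congr (_ + _); [rewrite mulrCA | rewrite addrCA].
- move=> f g; rewrite !fctE Xm Ym /GRing.scale /= !mulrDr !mulrDl -!addrA.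
  by rewrite -mulrA (mulrCA f a); congr (_ + _); rewrite addrCA.
Qed.

HB.instance Definition _ :=
  GRing.isSubmodClosed.Build _ _ derivation_pred derivation_submod_closed.
HB.instance Definition _ := [SubChoice_isSubLmodule of vfield by <:].

Lemma lie_bracket_subproof (X Y : vfield) :
  ((fun f => X (Y f) - Y (X f)) : C -> C^o) \in derivation_pred.
Proof.
have /set_mem[Xl Xm] := vfield_funP X; have /set_mem[Yl Ym] := vfield_funP Y.
have s1 : scst M 1 = 1 by apply/val_inj.
have XD f g : X (f + g) = X f + X g by have := Xl 1 f g; rewrite s1 !mul1r.
have YD f g : Y (f + g) = Y f + Y g by have := Yl 1 f g; rewrite s1 !mul1r.
apply/mem_set; split=> [a f g|f g] /=.
  by rewrite Yl !Xl Yl mulrBr opprD addrACA.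
rewrite Ym Xm !XD !YD !Xm !Ym.
by apply/val_inj/funext => p; rewrite /= !fctE /=; ring.
Qed.

End VectorFields.

Section Tensors.
Variables (R : realType) (d : nat) (M : manifold R d).
Local Notation C := (smooth_fun M).
Local Notation V := (vfield M).
Local Notation "a %:C" := (scst M a) (at level 2, format "a %:C").

(* Tensor fields are C-multilinear maps on the C-module V of vector fields: a
   (1,1) tensor field is a C-linear V -> V, a 1-form is a C-linear V -> C. *)

Definition lie_bracket (X Y : V) : V := VField (lie_bracket_subproof X Y).

(* Nondegeneracy is required at every point: a tangent vector orthogonal to all
   tangent vectors at p is zero. Tangent vectors at p are all of the form X_p
   for a global vector field X. *)
Record pseudo_metric := PseudoMetric {
  metric :> V -> V -> C;
  metric_linear : forall X : V, scalar (metric X);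
  metric_sym : forall X Y : V, metric X Y = metric Y X;
  metric_nondegenerate : forall (p : M) (X : V),
    (forall Y : V, metric X Y p = 0) -> forall f : C, X f p = 0 }.

Record is_connection (nabla : V -> V -> V) : Prop := IsConnection {
  connection_linearl : forall Y : V, linear (nabla ^~ Y);
  connection_addr : forall X Y Z : V, nabla X (Y + Z) = nabla X Y + nabla X Z;
  connection_leibniz : forall (X : V) (f : C) (Y : V),
    nabla X (f *: Y) = X f *: Y + f *: nabla X Y }.

Record is_levi_civita (g : pseudo_metric) (nabla : V -> V -> V) : Prop :=
  IsLeviCivita {
  levi_civita_connection : is_connection nabla;
  levi_civita_torsion_free : forall X Y : V,
    nabla X Y - nabla Y X = lie_bracket X Y;
  levi_civita_metric : forall X Y Z : V,
    X (g Y Z) = g (nabla X Y) Z + g Y (nabla X Z) }.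

Definition curvature (nabla : V -> V -> V) (X Y Z : V) : V :=
  nabla X (nabla Y Z) - nabla Y (nabla X Z) - nabla (lie_bracket X Y) Z.

Definition cov_deriv_endo (nabla : V -> V -> V) (X : V) (A : V -> V) (Y : V) :=
  nabla X (A Y) - A (nabla X Y).

Definition lie_deriv_endo (X : V) (A : V -> V) (Y : V) : V :=
  lie_bracket X (A Y) - A (lie_bracket X Y).

Definition ext_deriv (eta : V -> C) (X Y : V) : C :=
  (2^-1)%:C * (X (eta Y) - Y (eta X) - eta (lie_bracket X Y)).

End Tensors.

Section ContactPseudoMetric.
Variables (R : realType) (n : nat) (M : manifold R n.*2.+1).
Local Notation C := (smooth_fun M).
Local Notation V := (vfield M).
Local Notation "a %:C" := (scst M a) (at level 2, format "a %:C").

Record almost_contact_pseudo_metric := AlmostContactPseudoMetric {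
  acphi : {linear V -> V};
  acxi : V;
  aceta : {scalar V};
  acg : pseudo_metric M;
  aceps : R;
  aceps_sign : aceps = 1 \/ aceps = -1;
  acphi_sq : forall X : V, acphi (acphi X) = - X + aceta X *: acxi;
  aceta_xi : aceta acxi = 1;
  acphi_xi : acphi acxi = 0;
  aceta_phi : forall X : V, aceta (acphi X) = 0;
  acg_compatible : forall X Y : V,
    acg (acphi X) (acphi Y) = acg X Y - aceps%:C * aceta X * aceta Y }.

Variable S : almost_contact_pseudo_metric.
Local Notation phi := (acphi S).
Local Notation xi := (acxi S).
Local Notation eta := (aceta S).
Local Notation g := (acg S).

Definition is_contact_pseudo_metric : Prop :=
  forall X Y : V, ext_deriv eta X Y = g X (phi Y).

Definition contact_h (X : V) : V := (2^-1)%:C *: lie_deriv_endo xi phi X.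

(* The sectional curvature K(xi, X_p), for X_p a unit vector in the kernel of
   eta; g X X p is its sign eps_X. *)
Definition xi_sectional (nabla : V -> V -> V) (X : V) (p : M) : R :=
  aceps S * g X X p * g (curvature nabla xi X X) xi p.

End ContactPseudoMetric.

(* Main.v *)
Require Import Defs.
From mathcomp Require Import all_boot all_order all_algebra.
From mathcomp Require Import boolp classical_sets functions.
From mathcomp Require Import reals topology.
From mathcomp Require Import ring.

(** The whole proof is an analysis of the shape operator A X = nabla_X xi.
    Throughout, e denotes eps and D denotes nabla_xi.

    Since eta o phi = 0, the contact condition in the direction xi says that
    L_xi eta = 0, which forces D xi = 0 ([xi_geodesic]).  In general the
    contact condition is the statement that the skew part of A is - e phi
    ([nabla_xi_antisym]).  Taking L_xi of it gives L_xi Phi = 0 ([lie_xi_Phi])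
    and hence a formula for D phi in terms of A and phi
    ([nabla_xi_phi_expand]).  By itself it does not give D phi = 0; but
    phi^2 = -I + eta (x) xi is D-parallel, and differentiating it with that
    formula yields phi A phi = A + 2 e phi ([nabla_xi_conj_phi]), which is
    exactly what makes the formula vanish ([nabla_xi_phi]).

    With phi parallel along xi, the definition of h unfolds to
    h = phi A + e phi^2, whence A = - e phi - phi h and h phi = - phi h.
    Squaring, A^2 = phi^2 + h^2, while phi (D h) = - D A.  As xi is geodesic,
    R(xi, X) xi = (D A) X + A^2 X, so that
      R(xi, X) xi = phi^2 X + h^2 X - phi ((D h) X)   ([jacobi_operator]).
    Pairing with X gives the first formula.  For the second, replace X by
    phi X: h^2 commutes with phi and D h anticommutes with it, so only the last
    term changes sign, and the two formulas are subtracted.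

    Everything except the last step is an identity between global tensor
    fields, valid for all X; the hypotheses on X at the point p enter only in
    the theorem itself.  Equalities of vector fields are mostly reduced by
    nondegeneracy of the metric ([metric_eq]) to identities in the commutative
    ring of smooth functions. *)

Set Implicit Arguments.
Unset Strict Implicit.
Unset Printing Implicit Defensive.

Import GRing.Theory.

Local Open Scope ring_scope.

Local Notation "a %:C" := (scst _ a) (at level 2, format "a %:C").

(** * Vector fields as derivations *)

Section Derivations.
Variables (R : realType) (d : nat) (M : manifold R d).
Local Notation C := (smooth_fun M).
Implicit Types (X Y Z : vfield M) (f : C).

Lemma scst1 : (1 : R)%:C = 1 :> C.
Proof. exact/val_inj. Qed.

Lemma scstM (a b : R) : (a * b)%:C = a%:C * b%:C :> C.
Proof. exact/val_inj. Qed.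

Lemma scst_half : (2^-1 : R)%:C + (2^-1)%:C = 1 :> C.
Proof.
have <- : (2^-1 + 2^-1 : R)%:C = (2^-1)%:C + (2^-1)%:C :> C by exact/val_inj.
by rewrite -scst1; congr (_ %:C); field.
Qed.

Lemma vfield_linear X (a : R) f f' : X (a%:C * f + f') = a%:C * X f + X f'.
Proof. by have /set_mem[] := vfield_funP X. Qed.

Lemma vfieldM X f f' : X (f * f') = X f * f' + f * X f'.
Proof. by have /set_mem[] := vfield_funP X. Qed.

Lemma vfieldD X : {morph X : f f' / f + f'}.
Proof.
by move=> f f'; have := vfield_linear X 1 f f'; rewrite scst1 !mul1r.
Qed.

Lemma vfield0 X : X 0 = 0.
Proof. by apply: (addrI (X 0)); rewrite -vfieldD !addr0. Qed.

Lemma vfieldN X : {morph X : f / - f}.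
Proof. by move=> f; apply: (addrI (X f)); rewrite -vfieldD !subrr vfield0. Qed.

Lemma vfieldB X : {morph X : f f' / f - f'}.
Proof. by move=> f f'; rewrite vfieldD vfieldN. Qed.

Lemma vfieldZ X (a : R) f : X (a%:C * f) = a%:C * X f.
Proof. by have := vfield_linear X a f 0; rewrite vfield0 !addr0. Qed.

Lemma vfield_cst X (a : R) : X a%:C = 0.
Proof.
suff X1 : X 1 = 0 by rewrite -(mulr1 a%:C) vfieldZ X1 mulr0.
by apply: (addrI (X 1)); rewrite addr0 -{3}(mulr1 1) vfieldM mulr1 mul1r.
Qed.

Lemma vfield_eq X Y : (forall f, X f = Y f) -> X = Y.
Proof. by move=> XY; apply/val_inj/funext. Qed.

Lemma lie_bracketE X Y f : lie_bracket X Y f = X (Y f) - Y (X f).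
Proof. by []. Qed.

Lemma lie_jacobi X Y Z : lie_bracket X (lie_bracket Y Z) =
  lie_bracket (lie_bracket X Y) Z + lie_bracket Y (lie_bracket X Z).
Proof.
apply: vfield_eq => f.
rewrite [RHS](_ : _ = lie_bracket (lie_bracket X Y) Z f
  + lie_bracket Y (lie_bracket X Z) f) //.
by rewrite !lie_bracketE !vfieldB; ring.
Qed.

Lemma vfield_double_eq0 X : X + X = 0 -> X = 0.
Proof.
move=> XX.
by rewrite -[X]scale1r -scst_half scalerDl -scalerDr XX scaler0.
Qed.

End Derivations.

(** * Metrics and connections *)

Section Metric.
Variables (R : realType) (d : nat) (M : manifold R d) (g : pseudo_metric M).
Local Notation C := (smooth_fun M).
Implicit Types (X Y Z W : vfield M) (f : C).

Lemma metricDr Z X Y : g Z (X + Y) = g Z X + g Z Y.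
Proof. by have := metric_linear g Z 1 X Y; rewrite scale1r /= mul1r. Qed.

Lemma metric0r Z : g Z 0 = 0.
Proof. by apply: (addrI (g Z 0)); rewrite -metricDr !addr0. Qed.

Lemma metricZr f Z X : g Z (f *: X) = f * g Z X.
Proof. by have := metric_linear g Z f X 0; rewrite metric0r !addr0. Qed.

Lemma metricNr Z X : g Z (- X) = - g Z X.
Proof. by rewrite -scaleN1r metricZr mulN1r. Qed.

Lemma metricDl X Y Z : g (X + Y) Z = g X Z + g Y Z.
Proof. by rewrite !(Defs.metric_sym g _ Z) metricDr. Qed.

Lemma metric0l Z : g 0 Z = 0.
Proof. by rewrite Defs.metric_sym metric0r. Qed.

Lemma metricZl f X Z : g (f *: X) Z = f * g X Z.
Proof. by rewrite !(Defs.metric_sym g _ Z) metricZr. Qed.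

Lemma metricNl X Z : g (- X) Z = - g X Z.
Proof. by rewrite !(Defs.metric_sym g _ Z) metricNr. Qed.

Definition metric_linE := (metricDl, metricNl, metricZl, metric0l,
  metricDr, metricNr, metricZr, metric0r).

Lemma metric_eq X Y : (forall Z, g X Z = g Y Z) -> X = Y.
Proof.
move=> gXY; apply/subr0_eq/vfield_eq => f; apply/val_inj/funext => p.
apply: (metric_nondegenerate (p0 := g)) => Z.
by rewrite metricDl metricNl gXY subrr.
Qed.

End Metric.

Section Connection.
Variables (R : realType) (d : nat) (M : manifold R d).
Variable nabla : vfield M -> vfield M -> vfield M.
Implicit Types (X Y Z W : vfield M) (f : smooth_fun M).

Section Linearity.
Hypothesis conn : is_connection nabla.

Lemma connectionDl X Y Z : nabla (X + Y) Z = nabla X Z + nabla Y Z.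
Proof. by have := connection_linearl conn Z 1 X Y; rewrite /= !scale1r. Qed.

Lemma connection0l Z : nabla 0 Z = 0.
Proof. by apply: (addrI (nabla 0 Z)); rewrite -connectionDl !addr0. Qed.

Lemma connectionZl f X Z : nabla (f *: X) Z = f *: nabla X Z.
Proof.
by have := connection_linearl conn Z f X 0; rewrite /= connection0l !addr0.
Qed.

Lemma connectionNl X Z : nabla (- X) Z = - nabla X Z.
Proof. by rewrite -!scaleN1r connectionZl. Qed.

Lemma connection0r X : nabla X 0 = 0.
Proof.
by apply: (addrI (nabla X 0)); rewrite -(connection_addr conn) !addr0.
Qed.

Lemma connectionNr X Y : nabla X (- Y) = - nabla X Y.
Proof.
apply: (addrI (nabla X Y)).
by rewrite -(connection_addr conn) !subrr connection0r.
Qed.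

Lemma connection_scst X (a : R) Y : nabla X (a%:C *: Y) = a%:C *: nabla X Y.
Proof. by rewrite (connection_leibniz conn) vfield_cst scale0r add0r. Qed.

End Linearity.

Variable g : pseudo_metric M.
Hypothesis lc : is_levi_civita g nabla.

(** The function g Z W is differentiated along the bracket of X and Y in two
    ways, by the metric property once for the bracket and twice for the
    commutator X Y - Y X; in the commutator the mixed terms cancel. *)
Lemma curvature_skew X Y Z W :
  g (curvature nabla X Y Z) W = - g (curvature nabla X Y W) Z.
Proof.
have nablaM := levi_civita_metric lc.
have := lie_bracketE X Y (g Z W); rewrite !nablaM !vfieldD !nablaM.
move/(canRL (addrK _)) => E.
by rewrite (Defs.metric_sym g _ Z) /curvature !metric_linE E; ring.
Qed.

End Connection.

(** * The structure tensors *)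

Section Contact.
Variables (R : realType) (n : nat) (M : manifold R n.*2.+1).
Variable S : almost_contact_pseudo_metric M.
Local Notation C := (smooth_fun M).
Local Notation phi := (acphi S).
Local Notation xi := (acxi S).
Local Notation eta := (aceta S).
Local Notation g := (acg S).
Local Notation e := ((aceps S)%:C : C).
Implicit Types (X Y Z W : vfield M) (f : C).

Lemma aceps_sqr : aceps S * aceps S = 1.
Proof. by case: (aceps_sign S) => ->; rewrite ?mulrNN mulr1. Qed.

Lemma aceps_sqrC : e * e = 1.
Proof. by rewrite -scstM aceps_sqr scst1. Qed.

Lemma metric_xi X : g X xi = e * eta X.
Proof.
have := acg_compatible S X xi; rewrite acphi_xi aceta_xi metric0r mulr1.
by move/esym/subr0_eq.
Qed.

Lemma etaE X : eta X = e * g X xi.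
Proof. by rewrite metric_xi mulrA aceps_sqrC mul1r. Qed.

Lemma phi_skew X Y : g (phi X) Y = - g X (phi Y).
Proof.
have := acg_compatible S X (phi Y).
rewrite acphi_sq aceta_phi mulr0 subr0 => <-.
by rewrite !metric_linE metric_xi aceta_phi !mulr0 addr0 opprK.
Qed.

Lemma phiZ f X : phi (f *: X) = f *: phi X.
Proof. exact: linearZ. Qed.

Lemma etaZ f X : eta (f *: X) = f * eta X.
Proof. exact: linearZ. Qed.

Lemma phi_cube X : phi (phi (phi X)) = - phi X.
Proof. by rewrite acphi_sq aceta_phi scale0r addr0. Qed.

(** * The covariant derivative of the Reeb field *)

Variable nabla : vfield M -> vfield M -> vfield M.
Hypothesis lc : is_levi_civita g nabla.
Let conn := levi_civita_connection lc.
Local Notation A X := (nabla X xi).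
Local Notation D := (nabla xi).

Lemma metric_nabla_xi X : g (A X) xi = 0.
Proof.
have := levi_civita_metric lc X xi xi.
rewrite metric_xi aceta_xi mulr1 vfield_cst (Defs.metric_sym g xi) => E.
by rewrite -[LHS]mul1r -scst_half mulrDl -mulrDr -E mulr0.
Qed.

Lemma eta_nabla_xi X : eta (A X) = 0.
Proof. by rewrite etaE metric_nabla_xi mulr0. Qed.

Lemma deriv_eta X Y : X (eta Y) = eta (nabla X Y) + e * g Y (A X).
Proof.
by rewrite etaE vfieldZ (levi_civita_metric lc) mulrDr -etaE.
Qed.

Lemma lie_nabla X Y : lie_bracket X Y = nabla X Y - nabla Y X.
Proof. by rewrite (levi_civita_torsion_free lc). Qed.

Hypothesis contact : is_contact_pseudo_metric S.

Lemma contactE X Y :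
  X (eta Y) - Y (eta X) - eta (lie_bracket X Y) = g X (phi Y) + g X (phi Y).
Proof. by rewrite -contact -mulrDl scst_half mul1r. Qed.

(** This is L_xi eta = 0: it holds because xi lies in the kernel of
    Phi = d eta and eta xi is constant. *)
Lemma deriv_eta_xi X : xi (eta X) = eta (lie_bracket xi X).
Proof.
have := contactE xi X.
rewrite Defs.metric_sym metric_xi aceta_phi mulr0 addr0.
by rewrite aceta_xi -scst1 vfield_cst subr0; move/subr0_eq.
Qed.

(** Since A X is orthogonal to xi, L_xi eta = 0 leaves g(X, D xi) = 0. *)
Lemma xi_geodesic : D xi = 0.
Proof.
apply: (@metric_eq _ _ _ g) => X; rewrite metric0l.
have := deriv_eta_xi X.
rewrite deriv_eta lie_nabla linearB /= eta_nabla_xi subr0.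
rewrite -[RHS]addr0 => /addrI E.
by rewrite Defs.metric_sym -[LHS]mul1r -aceps_sqrC -mulrA E mulr0.
Qed.

Lemma eta_nabla_along_xi X : xi (eta X) = eta (D X).
Proof. by rewrite deriv_eta xi_geodesic metric0r mulr0 addr0. Qed.

(** Writing eta as e g(-, xi) turns d eta (X, Y) into half of
    e (g(Y, A X) - g(X, A Y)), so the contact condition fixes the skew part of
    the shape operator. *)
Lemma nabla_xi_antisym X Y :
  g (A X) Y = g X (A Y) + e * (g X (phi Y) + g X (phi Y)).
Proof.
have := contactE X Y; rewrite !deriv_eta lie_nabla linearB /= => E.
rewrite (Defs.metric_sym g _ Y) -[LHS]mul1r -aceps_sqrC -E.
have ee := aceps_sqrC.
by ring: ee.
Qed.

(** Here Phi = d eta, and L_xi commutes with d, so L_xi Phi = d (L_xi eta) = 0;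
    the commutation amounts to the Jacobi identity. *)
Lemma lie_xi_Phi X Y : xi (g X (phi Y)) =
  g (lie_bracket xi X) (phi Y) + g X (phi (lie_bracket xi Y)).
Proof.
rewrite -!contact /ext_deriv vfieldZ !vfieldB.
rewrite (deriv_eta_xi (lie_bracket X Y)) lie_jacobi linearD /=.
by rewrite -!deriv_eta_xi; ring.
Qed.

(** Rewriting L_xi Phi = 0 with the torsion-free connection expresses D phi by
    the adjoint of A, which differs from A by the known skew part. *)
Lemma nabla_xi_phi_expand Y : D (phi Y) - phi (D Y) =
  - (A (phi Y) + phi (A Y) + (e + e) *: phi (phi Y)).
Proof.
apply: (@metric_eq _ _ _ g) => X; rewrite !(Defs.metric_sym g _ X).
have := lie_xi_Phi X Y; rewrite (levi_civita_metric lc) !lie_nabla.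
rewrite (linearB phi) /= !metric_linE (nabla_xi_antisym X) => E.
rewrite -[g X (D (phi Y))](addKr (g (D X) (phi Y))) E.
ring.
Qed.

Lemma nabla_xi_phi_sq Y : D (phi (phi Y)) = phi (phi (D Y)).
Proof.
rewrite !acphi_sq (connection_addr conn) (connectionNr conn).
rewrite (connection_leibniz conn) xi_geodesic scaler0 addr0.
by rewrite eta_nabla_along_xi.
Qed.

Lemma nabla_phi_sq Y : A (phi (phi Y)) = - A Y.
Proof.
rewrite acphi_sq (connectionDl conn) (connectionNl conn) (connectionZl conn).
by rewrite xi_geodesic scaler0 addr0.
Qed.

Lemma phi_sq_nabla Y : phi (phi (A Y)) = - A Y.
Proof. by rewrite acphi_sq eta_nabla_xi scale0r addr0. Qed.

(** Parallelism of phi^2 reads (D phi) phi + phi (D phi) = 0.  Substituting the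
    expansion of D phi, this sum is -2 (phi A phi - A - 2 e phi). *)
Lemma nabla_xi_conj_phi Y : phi (A (phi Y)) = A Y + (e + e) *: phi Y.
Proof.
have E : (D (phi (phi Y)) - phi (D (phi Y))) + phi (D (phi Y) - phi (D Y)) = 0.
  by rewrite linearB /= addrA subrK nabla_xi_phi_sq subrr.
rewrite !nabla_xi_phi_expand linearN !linearD phiZ /= in E.
rewrite nabla_phi_sq phi_sq_nabla phi_cube in E.
apply/subr0_eq/vfield_double_eq0.
rewrite -oppr0 -{}E.
apply: (@metric_eq _ _ _ g) => Z; rewrite !metric_linE; ring.
Qed.

Lemma nabla_xi_anticomm_phi Y :
  phi (A Y) + A (phi Y) = - ((e + e) *: phi (phi Y)).
Proof.
have := congr1 phi (nabla_xi_conj_phi Y).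
rewrite phi_sq_nabla linearD phiZ /= => E; rewrite -[A (phi Y)]opprK E.
apply: (@metric_eq _ _ _ g) => Z; rewrite !metric_linE; ring.
Qed.

(** [nabla_xi_anticomm_phi] is phi applied to [nabla_xi_conj_phi], and it is
    the vanishing of the right-hand side of [nabla_xi_phi_expand]. *)
Lemma nabla_xi_phi Y : D (phi Y) = phi (D Y).
Proof.
apply/subr0_eq; rewrite nabla_xi_phi_expand (addrC (A _)).
by rewrite nabla_xi_anticomm_phi addNr oppr0.
Qed.

(** * The tensor h *)

Local Notation h := (contact_h S).

(** As D phi = 0, the D-terms of L_xi phi cancel and 2 h = phi A - A phi;
    the anticommutation rule then eliminates A phi. *)
Lemma contact_hE X : h X = phi (A X) + e *: phi (phi X).
Proof.
have E := congr1 (fun V => V - A (phi X)) (nabla_xi_anticomm_phi X).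
rewrite /= addrK in E.
rewrite /contact_h /lie_deriv_endo !lie_nabla (linearB phi) /= nabla_xi_phi.
rewrite -[RHS]scale1r -scst_half scalerDl -scalerDr; congr (_ *: _).
rewrite E; apply: (@metric_eq _ _ _ g) => Z; rewrite !metric_linE; ring.
Qed.

Lemma contact_hD X Y : h (X + Y) = h X + h Y.
Proof.
by rewrite !contact_hE (connectionDl conn) !(linearD phi) /= scalerDr addrACA.
Qed.

Lemma contact_hZ f X : h (f *: X) = f *: h X.
Proof.
rewrite !contact_hE (connectionZl conn) !phiZ.
apply: (@metric_eq _ _ _ g) => Z; rewrite !metric_linE; ring.
Qed.

Lemma contact_hN X : h (- X) = - h X.
Proof. by rewrite -!scaleN1r contact_hZ. Qed.

Lemma eta_h X : eta (h X) = 0.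
Proof. by rewrite contact_hE linearD etaZ /= !aceta_phi mulr0 addr0. Qed.

Lemma phi_h X : phi (h X) = - A X - e *: phi X.
Proof.
by rewrite contact_hE linearD phiZ /= phi_cube phi_sq_nabla scalerN.
Qed.

Lemma h_phi X : h (phi X) = - phi (h X).
Proof.
rewrite phi_h contact_hE nabla_xi_conj_phi phi_cube.
apply: (@metric_eq _ _ _ g) => Z; rewrite !metric_linE; ring.
Qed.

Lemma nabla_xiE X : A X = - (e *: phi X) - phi (h X).
Proof.
rewrite phi_h; apply: (@metric_eq _ _ _ g) => Z; rewrite !metric_linE; ring.
Qed.

Lemma h_phi_sq X : h (phi (phi X)) = - h X.
Proof. by rewrite !h_phi (linearN phi) opprK acphi_sq eta_h scale0r addr0. Qed.

(** The formula A = - e phi - phi h is used for the outer A only; the inner one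
    appears as phi (A X), which [contact_hE] expresses by h. *)
Lemma nabla_xi_sq X : A (A X) = phi (phi X) + h (h X).
Proof.
have phiA : phi (A X) = h X - e *: phi (phi X) by rewrite contact_hE addrK.
have ee := aceps_sqrC.
rewrite nabla_xiE -h_phi phiA contact_hD contact_hN contact_hZ h_phi_sq.
apply: (@metric_eq _ _ _ g) => Z; rewrite !metric_linE; ring: ee.
Qed.

(** * Curvature in the direction of the Reeb field *)

Local Notation Dh := (cov_deriv_endo nabla xi h).

Lemma cov_deriv_hE X : Dh X = phi (D (A X) - A (D X)).
Proof.
rewrite /cov_deriv_endo !contact_hE (connection_addr conn).
rewrite (connection_scst conn) !nabla_xi_phi linearB /=.
by rewrite opprD addrACA subrr addr0.
Qed.

(** Applying phi to D h = phi (D A) gives - D A because D A takes values in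
    the kernel of eta, that kernel being preserved by D. *)
Lemma phi_cov_deriv_h X : phi (Dh X) = - (D (A X) - A (D X)).
Proof.
rewrite cov_deriv_hE acphi_sq (linearB eta) /= -eta_nabla_along_xi.
by rewrite !eta_nabla_xi vfield0 subrr scale0r addr0.
Qed.

Lemma cov_deriv_h_phi X : Dh (phi X) = - phi (Dh X).
Proof.
rewrite /cov_deriv_endo h_phi nabla_xi_phi h_phi (connectionNr conn).
by rewrite nabla_xi_phi linearB /= opprB opprK addrC.
Qed.

Lemma eta_cov_deriv_h X : eta (Dh X) = 0.
Proof. by rewrite cov_deriv_hE aceta_phi. Qed.

(** Here D xi = 0 kills the middle term, and [xi, X] = D X - A X contributes
    A (A X) besides completing D (A X) to (D A) X. *)
Lemma jacobi_operator X :
  curvature nabla xi X xi = phi (phi X) + h (h X) - phi (Dh X).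
Proof.
rewrite /curvature xi_geodesic (connection0r conn) subr0 lie_nabla.
rewrite (connectionDl conn) (connectionNl conn) nabla_xi_sq phi_cov_deriv_h.
apply: (@metric_eq _ _ _ g) => Z; rewrite !metric_linE; ring.
Qed.

Lemma curvature_xi X : g (curvature nabla xi X X) xi =
  g X X - e * eta X * eta X - g (h (h X)) X - g (Dh X) (phi X).
Proof.
rewrite (curvature_skew lc) jacobi_operator.
(* Generalizing keeps the linearity rules from unfolding h and D h. *)
move: (Dh X) (h (h X)) => V W; rewrite !metric_linE.
rewrite (phi_skew (phi X)) (phi_skew V).
rewrite acg_compatible.
ring.
Qed.

Lemma curvature_xi_phi X : g (curvature nabla xi (phi X) (phi X)) xi =
  g X X - e * eta X * eta X - g (h (h X)) X + g (Dh X) (phi X).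
Proof.
rewrite curvature_xi aceta_phi !h_phi contact_hN h_phi cov_deriv_h_phi opprK.
rewrite metricNl !acg_compatible !eta_h !eta_cov_deriv_h aceta_phi.
ring.
Qed.

End Contact.

Theorem theorem5p3 (R : realType) (n : nat) (M : manifold R n.*2.+1)
    (S : almost_contact_pseudo_metric M) (contact : is_contact_pseudo_metric S)
    (nabla : vfield M -> vfield M -> vfield M)
    (levi_civita : is_levi_civita (acg S) nabla)
    (p : M) (X : vfield M) (epsX : R)
    (X_ker : aceta S X p = 0)
    (X_unit : acg S X X p = epsX) (epsX_sign : epsX = 1 \/ epsX = -1) :
  let g := acg S in
  let phi := acphi S in
  let xi := acxi S in
  let eps := aceps S in
  let h := contact_h S in
  let nabla_xi_h := cov_deriv_endo nabla xi h in
  let K := xi_sectional S nabla in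
  K X p = eps * (1 - epsX * g (h (h X)) X p - epsX * g (nabla_xi_h X) (phi X) p)
  /\
  K X p = K (phi X) p - 2 * eps * epsX * g (nabla_xi_h X) (phi X) p.
Proof.
move=> g phi xi eps h nabla_xi_h K.
have epsX2 : epsX * epsX = 1.
  by case: epsX_sign => ->; rewrite ?mulrNN mulr1.
have gphi : g (phi X) (phi X) p = epsX.
  by rewrite acg_compatible /= !fctE /= X_ker X_unit mulr0 subr0.
have KX : K X p =
    eps * epsX * (epsX - g (h (h X)) X p - g (nabla_xi_h X) (phi X) p).
  rewrite /K /xi_sectional (curvature_xi levi_civita contact) X_unit.
  by rewrite /= !fctE /= X_ker X_unit mulr0 subr0.
have KphiX : K (phi X) p =
    eps * epsX * (epsX - g (h (h X)) X p + g (nabla_xi_h X) (phi X) p).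
  rewrite /K /xi_sectional (curvature_xi_phi levi_civita contact) gphi.
  by rewrite /= !fctE /= X_ker X_unit mulr0 subr0.
split; last by rewrite KX KphiX; ring.
rewrite KX; ring: epsX2.
Qed.
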